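(* The modal propagator depends on the grid only through the scalar $z_{\boldsymbol k}^{(N)}=cT^\alpha(q_{\boldsymbol k}^{(N)})^s$, via $g_\alpha(z)=E_\alpha(-z)$. Interpolation of $p$-th order on a fixed one-dimensional log-spaced table of $M$ nodes has uniform defect $$\sup_z|g_\alpha(z)-(\mathcal I_Mg_\alpha)(z)|=:\varepsilon_{\rm tab}\le C_pM^{-p},$$ independent of $N$, and the assembled base field satisfies $$\|u_{\rm base}^N-u_{\rm base}^{\star,N}\|_{L_2}\le\varepsilon_{\rm tab}\,\|u_0\|_{L_2}.$$
   Context: $\alpha\in(0,1]$, $s\in(0,1]$, $c>0$, $T>0$, and $E_\alpha(z)=\sum_{n\ge0}z^n/\Gamma(1+\alpha n)$ is the Mittag--Leffler function. $N$ is the spatial grid resolution and $q_{\boldsymbol k}^{(N)}$ the eigenvalue of the five-point discrete negative Laplacian on mode $\boldsymbol k$ of the $N$-grid. $\mathcal I_M$ denotes $p$-th order interpolation on a fixed log-spaced grid of $M$ nodes; the supremum is over the values $z$ covered by the table. $u_{\rm base}^{\star,N}$ is obtained from $u_0$ on the $N$-grid by multiplying each coefficient in the orthonormal discrete sine basis by $g_\alpha(z_{\boldsymbol k}^{(N)})$, and $u_{\rm base}^{N}$ by multiplying instead by the interpolated value $(\mathcal I_Mg_\alpha)(z_{\boldsymbol k}^{(N)})$. $C_p$ depends on $p$ (and on $\alpha$ and the table range) but not on $M$ or $N$. *)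

(* Defs.v *)
From HB Require Import structures.
From mathcomp Require Import all_boot all_order all_algebra.
From mathcomp Require Import all_classical all_reals all_analysis.
From mathcomp Require Import zify ring lra.

Set Implicit Arguments.
Unset Strict Implicit.
Unset Printing Implicit Defensive.

Import Order.TTheory GRing.Theory Num.Theory.
Import numFieldNormedType.Exports.

Local Open Scope classical_set_scope.
Local Open Scope ring_scope.

Section MittagLeffler.
Variable R : realType.

(* Euler's integral; only evaluated at x >= 1. *)
Definition Gamma (x : R) : R :=
  \int[@lebesgue_measure R]_(t in `]0, +oo[) (t `^ (x - 1) * expR (- t)).

Definition mittag_leffler (alpha z : R) : R :=
  limn (series (fun n => z ^+ n / Gamma (1 + alpha * n%:R))).

Definition g_ml (alpha z : R) : R := mittag_leffler alpha (- z).

End MittagLeffler.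

Section Table.
Variable R : realType.

(* M nodes, node 0 = zmin and node M.-1 = zmax, equally spaced in ln z. *)
Definition table_node (zmin zmax : R) (M i : nat) : R :=
  zmin * (zmax / zmin) `^ (i%:R / M.-1%:R).

(* j z is the first node of the p consecutive nodes used to interpolate at z.
   For p >= 2 these nodes surround z; for p = 1 (a single node, piecewise
   constant interpolation) the node is an end of a cell containing z, and is z
   itself when z is a node. *)
Definition is_stencil (p : nat) (zmin zmax : R) (M : nat) (j : R -> nat) :=
  forall z, zmin <= z <= zmax ->
    (j z + p <= M)%N /\
    if p == 1%N then
      `|ln z - ln (table_node zmin zmax M (j z))| < ln (zmax / zmin) / M.-1%:R
    else
      table_node zmin zmax M (j z) <= z
        <= table_node zmin zmax M (j z + p).-1.

(* Value at z of the polynomial of degree < p in the variable x that agrees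
   with f at the p nodes of the stencil of z (Lagrange form). *)
Definition table_interp (p : nat) (zmin zmax : R) (x : R -> R) (M : nat)
    (j : R -> nat) (f : R -> R) (z : R) : R :=
  let node a := table_node zmin zmax M (j z + a) in
  \sum_(a < p) f (node a) *
    \prod_(b < p | b != a) ((x z - x (node b)) / (x (node a) - x (node b))).

(* The supremum is taken in \bar R, since the supremum of an unbounded set of
   reals is 0 by convention. *)
Definition eps_tab (alpha : R) (p : nat) (zmin zmax : R) (x : R -> R)
    (M : nat) (j : R -> nat) : \bar R :=
  ereal_sup [set (`|g_ml alpha z -
                    table_interp p zmin zmax x M j (g_ml alpha) z|)%:E
            | z in [set z | zmin <= z <= zmax]].

End Table.

(* Functions on the N x N interior nodes ((i+1)h, (j+1)h), h = 1/(N+1), of the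
   unit square, with homogeneous Dirichlet boundary values. *)
Section Grid.
Variables (R : realType) (N : nat).
Implicit Types (u v : 'M[R]_N) (m q : 'I_N -> 'I_N -> R).

Definition mesh : R := N.+1%:R^-1.

Definition grid_dot u v : R := mesh ^+ 2 * \sum_i \sum_j u i j * v i j.

Definition grid_L2norm u : R := Num.sqrt (grid_dot u u).

(* Neighbours of the node (i, j) lying on the boundary contribute 0, hence do
   not appear in the sums. *)
Definition neg_laplacian5 u : 'M[R]_N :=
  \matrix_(i, j) ((4 * u i j
    - \sum_(a < N | (a.+1 == i :> nat) || (i.+1 == a :> nat)) u a j
    - \sum_(b < N | (b.+1 == j :> nat) || (j.+1 == b :> nat)) u i b)
    / mesh ^+ 2).

(* sin(k pi x) at x = i h *)
Definition sine1 (k i : nat) : R := sin (k%:R * pi * (i%:R * mesh)).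

(* Orthonormal for grid_dot; the index k : 'I_N stands for wave number k+1. *)
Definition sine_mode (k l : 'I_N) : 'M[R]_N :=
  \matrix_(i, j) (2 * sine1 k.+1 i.+1 * sine1 l.+1 j.+1).

Definition mode_coef u (k l : 'I_N) : R := grid_dot u (sine_mode k l).

Definition is_mode_eigenvalue q :=
  forall k l, neg_laplacian5 (sine_mode k l) = q k l *: sine_mode k l.

Definition mode_multiplier m u : 'M[R]_N :=
  \sum_k \sum_l (m k l * mode_coef u k l) *: sine_mode k l.

Definition mode_z (alpha s c T : R) q (k l : 'I_N) : R :=
  c * T `^ alpha * (q k l) `^ s.

Definition u_base_star (alpha s c T : R) q (u0 : 'M[R]_N) : 'M[R]_N :=
  mode_multiplier (fun k l => g_ml alpha (mode_z alpha s c T q k l)) u0.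

Definition u_base (alpha s c T : R) (p : nat) (zmin zmax : R) (x : R -> R)
    (M : nat) (j : R -> nat) q (u0 : 'M[R]_N) : 'M[R]_N :=
  mode_multiplier (fun k l => table_interp p zmin zmax x M j (g_ml alpha)
                                (mode_z alpha s c T q k l)) u0.

Lemma sum_adjacent_sine1 (k : nat) (i : 'I_N) :
  \sum_(a < N | (a.+1 == i :> nat) || (i.+1 == a :> nat)) sine1 k a.+1 =
  2 * cos (k%:R * pi * mesh) * sine1 k i.+1.
Proof.
have e0 : sine1 k 0 = 0 by rewrite /sine1 mul0r mulr0 sin0.
have eN : sine1 k N.+1 = 0.
  rewrite /sine1 /mesh divff ?pnatr_eq0 // mulr1.
  elim: k {e0} => [|k IH]; first by rewrite mul0r sin0.
  by rewrite -natr1 mulrDl mul1r sinD IH sinpi mul0r mulr0 addr0.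
have -> : \sum_(a < N | (a.+1 == i :> nat) || (i.+1 == a :> nat))
    sine1 k a.+1 = sine1 k i + sine1 k i.+2.
  rewrite (bigID (fun a : 'I_N => a.+1 == i :> nat)) /=; congr (_ + _).
    case: (posnP i) => [i0|i0].
      by rewrite i0 e0 big_pred0 // => a; rewrite andbF.
    have lt : (i.-1 < N)%N by rewrite prednK // ltnW.
    rewrite (big_pred1 (Ordinal lt)) /=; first by rewrite prednK.
    by move=> a /=; rewrite -(inj_eq val_inj) /=; lia.
  case: (ltnP i.+1 N) => [lt|le].
    rewrite (big_pred1 (Ordinal lt)) //= => a /=.
    by rewrite -(inj_eq val_inj) /=; lia.
  rewrite big_pred0; last by move=> a; have := ltn_ord a; lia.
  have -> : i.+2 = N.+1 by congr S; apply/eqP; rewrite eqn_leq le ltn_ord.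
  by rewrite eN.
rewrite /sine1.
have -> : k%:R * pi * (i%:R * mesh) =
    k%:R * pi * (i.+1%:R * mesh) - k%:R * pi * mesh :> R.
  by rewrite -[i.+1%:R]natr1; ring.
have -> : k%:R * pi * (i.+2%:R * mesh) =
    k%:R * pi * (i.+1%:R * mesh) + k%:R * pi * mesh :> R.
  by rewrite -[i.+2%:R]natr1; ring.
by rewrite sinB sinD; ring.
Qed.

Lemma mode_eigenvalueP :
  is_mode_eigenvalue (fun k l =>
    4 / mesh ^+ 2 * (sin (k.+1%:R * pi * mesh / 2) ^+ 2 +
                     sin (l.+1%:R * pi * mesh / 2) ^+ 2)).
Proof.
move=> k l; apply/matrixP => i j; rewrite !mxE.
under eq_bigr do rewrite mxE.
under [X in _ - _ - X]eq_bigr do rewrite mxE.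
rewrite -mulr_suml -mulr_sumr -mulr_sumr !sum_adjacent_sine1.
have cosE (t : R) : cos t = 1 - 2 * sin (t / 2) ^+ 2.
  have e : t = t / 2 + t / 2 by lra.
  by rewrite [in LHS]e cosD -!expr2 cos2sin2; ring.
rewrite !cosE; ring.
Qed.

End Grid.

(* Main.v *)
(* Restricting Euler's integral to ]K, K + 1[ gives
   1 / Gamma (1 + alpha n) <= e^(K + 1) K^(- alpha n) for every K >= 0, so that
   E_alpha is entire.  The interpolation error is linear in the function and
   vanishes on polynomials of degree < p in the coordinate x.  On a single power
   (- z)^n Taylor's formula in x, both for x = ln and for x = id, bounds it by a
   constant times W^n (stencil width)^p with W independent of n; the Lagrange
   basis is bounded because distances between nodes are comparable to their
   distances in ln z.  Summing over n against the coefficients of E_alpha gives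
   O(M^-p).  The L2 estimate is Bessel's inequality for the orthonormal sine
   modes. *)
Require Import Defs.
From HB Require Import structures.
From mathcomp Require Import all_boot all_order all_algebra.
From mathcomp Require Import all_classical all_reals all_analysis.
From mathcomp Require Import measurable_realfun ring lra zify.

Import Order.TTheory GRing.Theory Num.Theory.
Import numFieldNormedType.Exports.

Local Open Scope classical_set_scope.
Local Open Scope ring_scope.

Set Implicit Arguments.
Unset Strict Implicit.
Unset Printing Implicit Defensive.

(** * Orthonormality of the discrete sine modes and Bessel's inequality *)

Lemma sin_natpi (R : realType) (m : nat) : sin (m%:R * pi) = 0 :> R.
Proof.
elim: m => [|m IH]; first by rewrite mul0r sin0.
by rewrite -natr1 mulrDl mul1r sinD IH sinpi mul0r mulr0 addr0.
Qed.

Lemma cos_natpi (R : realType) (m : nat) : cos (m%:R * pi) = (-1) ^+ m :> R.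
Proof.
elim: m => [|m IH]; first by rewrite mul0r cos0 expr0.
by rewrite -natr1 mulrDl mul1r cosD IH cospi sinpi mulr0 subr0 exprSr.
Qed.

(** Multiplying by [2 * sin (phi / 2)], with [phi = m pi h], turns each summand into a difference of
    consecutive sines, and the sum telescopes. The bounds on [m] place [phi / 2] strictly between 0
    and [pi], so this factor can be cancelled. *)
Lemma sum_cos_mesh (R : realType) (N m : nat) : (0 < m < 2 * N.+1)%N ->
  \sum_(i < N.+1) cos (m%:R * pi * (i%:R * mesh R N)) =
  (1 - (-1) ^+ m) / 2 :> R.
Proof.
move=> /andP[m0 mN].
have h0 : 0 < mesh R N by rewrite /mesh invr_gt0 ltr0n.
have hN : N.+1%:R * mesh R N = 1 by rewrite /mesh divff ?pnatr_eq0.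
pose phi := m%:R * pi * mesh R N.
have s0 : 0 < sin (phi / 2).
  apply: sin_gt0_pi; rewrite /phi !divr_gt0 ?mulr_gt0 ?pi_gt0 ?ltr0n //=.
  rewrite ltr_pdivrMr // mulrAC [ltRHS]mulrC ltr_pM2r ?pi_gt0 //.
  rewrite /mesh ltr_pdivrMr ?ltr0n // -natrM ltr_nat; exact: mN.
apply: (@mulfI _ (2 * sin (phi / 2))); first by rewrite mulf_neq0 ?gt_eqF.
rewrite mulr_sumr.
pose f (i : nat) : R := sin (i%:R * phi - phi / 2).
have -> : \sum_(i < N.+1) 2 * sin (phi / 2) *
    cos (m%:R * pi * (i%:R * mesh R N)) = \sum_(0 <= i < N.+1) (f i.+1 - f i).
  rewrite big_mkord; apply: eq_bigr => i _.
  have -> : m%:R * pi * (i%:R * mesh R N) = i%:R * phi by rewrite /phi; ring.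
  rewrite /f; have -> : i.+1%:R * phi - phi / 2 = i%:R * phi + phi / 2.
    by rewrite -[i.+1%:R]natr1; field.
  by rewrite sinB sinD; ring.
rewrite telescope_sumr // /f mul0r sub0r sinN.
have -> : N.+1%:R * phi = m%:R * pi by rewrite /phi mulrCA hN mulr1.
by rewrite sinB sin_natpi cos_natpi; field.
Qed.

(** Product-to-sum reduces this to cosine sums of frequencies [k - l] and [k + l + 2]. These have
    the same parity, so off the diagonal the two sums cancel; on it the first equals [N + 1] and the
    second vanishes. *)
Lemma sum_sine1M (R : realType) (N : nat) (k l : 'I_N) :
  \sum_(i < N) sine1 R N k.+1 i.+1 * sine1 R N l.+1 i.+1 =
  N.+1%:R / 2 * (k == l)%:R.
Proof.
wlog lk : k l / (l <= k)%N.
  move=> H; case/orP: (leq_total l k) => [/H//|/H E].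
  by rewrite eq_sym -E; apply: eq_bigr => i _; rewrite mulrC.
(* The boundary node [i = 0], where the sines vanish, is added to match the range of
   [sum_cos_mesh]. *)
have -> : \sum_(i < N) sine1 R N k.+1 i.+1 * sine1 R N l.+1 i.+1 =
    \sum_(i < N.+1) sine1 R N k.+1 i * sine1 R N l.+1 i.
  by rewrite big_ord_recl /= /sine1 !mul0r !mulr0 sin0 mul0r add0r.
pose C (m : nat) : R := \sum_(i < N.+1) cos (m%:R * pi * (i%:R * mesh R N)).
have -> : \sum_(i < N.+1) sine1 R N k.+1 i * sine1 R N l.+1 i =
    (C (k - l)%N - C (k.+1 + l.+1)%N) / 2.
  rewrite /C -sumrB mulr_suml; apply: eq_bigr => i _.
  have -> : (k - l)%:R = k.+1%:R - l.+1%:R :> R.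
    by rewrite -natrB // subSS.
  rewrite natrD /sine1 !(mulrDl, mulNr) cosB cosD; by field.
have kN := ltn_ord k; have lN := ltn_ord l.
rewrite {2}/C sum_cos_mesh; last by apply/andP; split; lia.
case: (eqVneq k l) => [->|kl].
  rewrite subnn /C (eq_bigr (fun=> 1)); last by move=> i _; rewrite !mul0r cos0.
  rewrite sumr_const card_ord addnn -signr_odd odd_double expr0 mulr1; by field.
have kl' : (l < k)%N by rewrite ltn_neqAle lk andbT eq_sym.
rewrite /C sum_cos_mesh; last by apply/andP; split; lia.
have -> : (-1) ^+ (k - l) = (-1) ^+ (k.+1 + l.+1) :> R.
  rewrite -signr_odd -[RHS]signr_odd; congr (_ ^+ nat_of_bool _).
  by rewrite oddB // oddD /= addbN addNb negbK.
by rewrite subrr mul0r mulr0.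
Qed.

Lemma grid_dot_suml (R : realType) (N : nat) (I : finType) (a : I -> R)
    (phi : I -> 'M[R]_N) (v : 'M[R]_N) :
  grid_dot (\sum_i a i *: phi i) v = \sum_i a i * grid_dot (phi i) v.
Proof.
have D (u w : 'M[R]_N) : grid_dot (u + w) v = grid_dot u v + grid_dot w v.
  rewrite /grid_dot -mulrDr -big_split /=; congr (_ * _); apply: eq_bigr => i _.
  by rewrite -big_split /=; apply: eq_bigr => j _; rewrite mxE mulrDl.
have Z (c : R) (u : 'M[R]_N) : grid_dot (c *: u) v = c * grid_dot u v.
  rewrite /grid_dot mulrCA [c * _]mulr_sumr; congr (_ * _).
  apply: eq_bigr => i _.
  by rewrite mulr_sumr; apply: eq_bigr => j _; rewrite mxE mulrA.
have O : grid_dot 0 v = 0 by rewrite -(scale0r 0) Z mul0r.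
by rewrite (big_morph _ D O); apply: eq_bigr => i _.
Qed.

Lemma grid_dotC (R : realType) (N : nat) (u v : 'M[R]_N) :
  grid_dot u v = grid_dot v u.
Proof.
congr (_ * _); apply: eq_bigr => i _.
by apply: eq_bigr => j _; rewrite mulrC.
Qed.

Lemma grid_dot_ge0 (R : realType) (N : nat) (u : 'M[R]_N) : 0 <= grid_dot u u.
Proof.
rewrite mulr_ge0 ?sqr_ge0 // sumr_ge0 // => i _.
by rewrite sumr_ge0 // => j _; rewrite -expr2 sqr_ge0.
Qed.

Lemma sine_mode_orthonormal (R : realType) (N : nat) (k l k' l' : 'I_N) :
  grid_dot (sine_mode R k l) (sine_mode R k' l') =
  ((k == k') && (l == l'))%:R.
Proof.
rewrite /grid_dot.
under eq_bigr do under eq_bigr do rewrite !mxE.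
transitivity (mesh R N ^+ 2 *
    (2 * \sum_(i < N) sine1 R N k.+1 i.+1 * sine1 R N k'.+1 i.+1) *
    (2 * \sum_(i < N) sine1 R N l.+1 i.+1 * sine1 R N l'.+1 i.+1)).
  rewrite -mulrA; congr (_ * _).
  rewrite mulrACA mulr_suml mulr_sumr; apply: eq_bigr => i _.
  rewrite !mulr_sumr; apply: eq_bigr => j _; ring.
have N0 : N.+1%:R != 0 :> R by rewrite pnatr_eq0.
rewrite !sum_sine1M /mesh -mulnb natrM; move: (N.+1%:R) N0 => n n0.
by field.
Qed.

Lemma mode_multiplierE (R : realType) (N : nat) (m : 'I_N -> 'I_N -> R)
    (u : 'M[R]_N) :
  mode_multiplier m u = \sum_(k : 'I_N * 'I_N)
    (m k.1 k.2 * mode_coef u k.1 k.2) *: sine_mode R k.1 k.2.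
Proof. by rewrite /mode_multiplier pair_big. Qed.

Lemma mode_coef_multiplier (R : realType) (N : nat) (m : 'I_N -> 'I_N -> R)
    (u : 'M[R]_N) (k l : 'I_N) :
  mode_coef (mode_multiplier m u) k l = m k l * mode_coef u k l.
Proof.
rewrite {1}/mode_coef mode_multiplierE grid_dot_suml (bigD1 (k, l)) //=.
rewrite sine_mode_orthonormal !eqxx mulr1 big1 ?addr0 // => -[k' l'] /=.
by rewrite sine_mode_orthonormal xpair_eqE => /negPf ->; rewrite mulr0.
Qed.

Lemma grid_dot_multiplier (R : realType) (N : nat) (m : 'I_N -> 'I_N -> R)
    (u v : 'M[R]_N) :
  grid_dot (mode_multiplier m u) v =
  \sum_(k : 'I_N * 'I_N)
    m k.1 k.2 * mode_coef u k.1 k.2 * mode_coef v k.1 k.2.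
Proof.
rewrite mode_multiplierE grid_dot_suml; apply: eq_bigr => k _.
by rewrite [grid_dot _ v]grid_dotC.
Qed.

(** The multiplier 1 gives the orthogonal projection [w] of [u] onto the span of the modes. Since
    [w] and [u] have the same coefficients, the squared norm of [u - w] is that of [u] minus the sum
    of squares. *)
Lemma bessel_sine_mode (R : realType) (N : nat) (u : 'M[R]_N) :
  \sum_(k : 'I_N * 'I_N) mode_coef u k.1 k.2 ^+ 2 <= grid_dot u u.
Proof.
pose w := mode_multiplier (fun _ _ => 1) u.
have dotB (a b c : 'M[R]_N) : grid_dot (a - b) c = grid_dot a c - grid_dot b c.
  rewrite /grid_dot -mulrBr -sumrB; congr (_ * _); apply: eq_bigr => i _.
  by rewrite -sumrB; apply: eq_bigr => j _; rewrite !mxE mulrBl.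
have wv v : grid_dot w v =
    \sum_(k : 'I_N * 'I_N) mode_coef u k.1 k.2 * mode_coef v k.1 k.2.
  by rewrite grid_dot_multiplier; apply: eq_bigr => k _; rewrite mul1r.
have ww : grid_dot w w = grid_dot w u.
  rewrite !wv; apply: eq_bigr => k _.
  by rewrite mode_coef_multiplier mul1r.
have := grid_dot_ge0 (u - w).
rewrite dotB grid_dotC dotB [grid_dot w (u - w)]grid_dotC dotB.
rewrite [grid_dot u w]grid_dotC ww subrr subr0 subr_ge0 wv.
by under eq_bigr do rewrite -expr2.
Qed.

(** By orthonormality the squared norm of the image is the sum of the squares of
    [m k l * mode_coef u k l]; bounding each [m k l] by [e] leaves Bessel's inequality. *)
Lemma grid_L2norm_multiplier_le (R : realType) (N : nat)
    (m : 'I_N -> 'I_N -> R) (e : R) (u : 'M[R]_N) :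
  0 <= e -> (forall k l, `|m k l| <= e) ->
  grid_L2norm (mode_multiplier m u) <= e * grid_L2norm u.
Proof.
move=> e0 me; rewrite /grid_L2norm -(ger0_norm e0) -sqrtr_sqr.
rewrite -sqrtrM ?sqr_ge0 // ler_wsqrtr //.
apply: le_trans (ler_wpM2l (sqr_ge0 e) (bessel_sine_mode u)).
rewrite grid_dot_multiplier mulr_sumr; apply: ler_sum => k _.
rewrite mode_coef_multiplier mulrACA -!expr2 ler_wpM2r ?sqr_ge0 //.
by rewrite -real_normK ?num_real // lerXn2r ?nnegrE.
Qed.

(** * Growth of Gamma and convergence of the Mittag-Leffler series *)

(* The first disjunct covers a divergent integral, whose value is 0 by
   convention; it need not be excluded, because then 1 / Gamma x = 0 as well. *)
Lemma Gamma_lower (R : realType) (K x : R) : 0 <= K -> 1 <= x ->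
  Gamma x = 0 \/ K `^ (x - 1) * expR (- (K + 1)) <= Gamma x.
Proof.
move=> K0 x1; rewrite /Gamma /Rintegral.
set f := fun t : R => (t `^ (x - 1) * expR (- t))%:E.
have f0 t : (0 <= f t)%E by rewrite lee_fin mulr_ge0 ?powR_ge0 ?expR_ge0.
have mf D : measurable_fun D f.
  apply/measurable_EFinP; apply: measurable_funTS.
  apply: measurable_funM; first exact: measurable_powR.
  by apply: measurableT_comp => //; exact: measurableT_comp.
pose b := K + 1; pose c := K `^ (x - 1) * expR (- b).
rewrite -/b -/c.
have : ((c)%:E <=
    \int[@lebesgue_measure R]_(t in `]0%R, +oo[) f t)%E.
  apply: (@le_trans _ _ (\int[@lebesgue_measure R]_(t in `]K, b[) f t)%E);
      last first.
    apply: ge0_subset_integral => //; first exact: mf.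
    by move=> t /=; rewrite !in_itv /= andbT => /andP[/(le_lt_trans K0)].
  apply: (@le_trans _ _ (\int[@lebesgue_measure R]_(t in `]K, b[)
      (cst (c)%:E) t)%E).
    rewrite integral_cst //= lebesgue_measure_itv /= lte_fin /b ltrDl ltr01.
    by rewrite -EFinB addrAC subrr add0r mule1.
  apply: ge0_le_integral => //.
  - by move=> t _; rewrite lee_fin mulr_ge0 ?powR_ge0 ?expR_ge0.
  - exact: mf.
  - move=> t /=; rewrite in_itv /= => /andP[Kt tK].
    rewrite lee_fin ler_pM ?powR_ge0 ?expR_ge0 //.
      by rewrite ge0_ler_powR ?subr_ge0 ?nnegrE ?(ltW Kt) // (le_trans K0) ?ltW.
    by rewrite ler_expR lerN2 ltW.
case: (integral _ _ _) => [r| |] //=; last by left.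
by rewrite lee_fin; right.
Qed.

(** The coefficients of the series beat every geometric growth [W ^+ n], with a summable factor to
    spare; this is what later allows the errors on single powers to be summed. *)
Lemma inv_Gamma_le (R : realType) (alpha W : R) : 0 < alpha -> 0 < W ->
  exists2 B : R, 0 <= B &
    forall n, `|(Gamma (1 + alpha * n%:R))^-1| * W ^+ n <= B * 2^-1 ^+ n.
Proof.
(* With this [K], the lower bound on Gamma contains [K ^ (alpha n) = (2 W)^n], which absorbs
   [W ^+ n] and leaves [2^-1 ^+ n]. *)
move=> a0 W0; pose K : R := (2 * W) `^ alpha^-1.
have W2 : 0 < 2 * W by rewrite mulr_gt0.
exists (expR (K + 1)) => [|n]; first exact: expR_ge0.
have x1 : 1 <= 1 + alpha * n%:R by rewrite lerDl mulr_ge0 // ltW.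
have Kn : K `^ (1 + alpha * n%:R - 1) = (2 * W) ^+ n.
  rewrite addrAC subrr add0r /K -powRrM mulrA mulVf ?gt_eqF // mul1r.
  by rewrite powR_mulrn // ltW.
case: (Gamma_lower (powR_ge0 (2 * W) alpha^-1) x1) => [->|].
  by rewrite invr0 normr0 mul0r mulr_ge0 ?expR_ge0 // exprn_ge0.
rewrite -/K Kn => H.
have l0 : 0 < (2 * W) ^+ n * expR (- (K + 1)).
  by rewrite mulr_gt0 ?exprn_gt0 ?expR_gt0.
rewrite gtr0_norm ?invr_gt0 ?(lt_le_trans l0) //.
apply: (@le_trans _ _ (((2 * W) ^+ n * expR (- (K + 1)))^-1 * W ^+ n)).
  rewrite ler_wpM2r ?exprn_ge0 ?(ltW W0) // lef_pV2 // posrE.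
  exact: lt_le_trans H.
rewrite expRN invfM invrK exprMn invfM exprVn.
have Wn : W ^+ n != 0 by rewrite gt_eqF // exprn_gt0.
by rewrite le_eqVlt; apply/orP; left; apply/eqP; field; rewrite Wn expf_neq0.
Qed.

Lemma sum_half_le2 (R : realType) (m : nat) :
  \sum_(0 <= n < m) 2^-1 ^+ n <= 2 :> R.
Proof.
suff -> : \sum_(0 <= n < m) 2^-1 ^+ n = 2 - 2 * 2^-1 ^+ m :> R.
  by rewrite lerBlDr lerDl mulr_ge0 // exprn_ge0.
elim: m => [|m IH]; first by rewrite big_nil expr0 mulr1 subrr.
by rewrite big_nat_recr //= IH exprS; field.
Qed.

(** [limn] has a meaningful value only for a convergent sequence; comparison with a geometric series
    gives absolute convergence. The bound [W = |z| + 1] is used so that [W] is positive even at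
    [z = 0]. *)
Lemma g_ml_cvg (R : realType) (alpha z : R) : 0 < alpha ->
  series (fun n => (- z) ^+ n / Gamma (1 + alpha * n%:R)) @ \oo -->
  g_ml alpha z.
Proof.
move=> a0.
have W0 : 0 < `|z| + 1 by rewrite ltr_wpDl.
have [B B0 HB] := inv_Gamma_le a0 W0.
apply: normed_cvg.
apply: (@series_le_cvg _ _ (geometric B 2^-1)) => [n|n|n|] /=.
- exact: normr_ge0.
- by rewrite mulr_ge0 // exprn_ge0.
- apply: le_trans (HB n); rewrite normrM mulrC ler_wpM2l //.
  by rewrite normrX normrN lerXn2r ?nnegrE ?addr_ge0 // lerDl.
- apply: is_cvg_geometric_series.
  by rewrite gtr0_norm ?invr_gt0 // invf_lt1 // ltr1n.
Qed.

(** * Taylor remainders of powers, in the coordinates [id] and [ln] *)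

(** Each term splits off [|t| ^+ p]; what is left is at most [D ^+ (d i - p)], hence at most
    [D ^+ d i] because [D] is at least 1. *)
Lemma power_tail_le (R : realType) (I : Type) (r : seq I) (P : pred I)
    (c : I -> R) (d : I -> nat) (p : nat) (t D : R) :
  1 <= D -> `|t| <= D -> (forall i, P i -> 0 <= c i) ->
  (forall i, P i -> (p <= d i)%N) ->
  `|\sum_(i <- r | P i) c i * t ^+ d i| <=
  `|t| ^+ p * \sum_(i <- r | P i) c i * D ^+ d i.
Proof.
move=> D1 tD c0 dp; apply: le_trans (ler_norm_sum _ _ _) _.
rewrite mulr_sumr; apply: ler_sum => i Pi.
rewrite normrM (ger0_norm (c0 _ Pi)) mulrCA ler_wpM2l ?c0 // normrX.
rewrite -[in leLHS](subnKC (dp _ Pi)) exprD ler_wpM2l ?exprn_ge0 //.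
apply: (@le_trans _ _ (D ^+ (d i - p))).
  by rewrite lerXn2r ?nnegrE // (le_trans _ tD).
by rewrite ler_weXn2l // leq_subr.
Qed.

(** The binomial coefficients in [t] are nonnegative, so the tail beyond degree [p] is controlled by
    the whole expansion at [t = D]. The base [Y + D] depends neither on [n] nor on [y]. *)
Lemma exprn_taylor (R : realType) (D Y : R) (p n : nat) (y : R) :
  1 <= D -> 0 <= y <= Y -> exists d : nat -> R, forall t, `|t| <= D ->
    `|(y + t) ^+ n - \sum_(k < p) d k * t ^+ k| <= `|t| ^+ p * (Y + D) ^+ n.
Proof.
move=> D1 /andP[y0 yY].
(* Padding with zeros beyond [n] lets the expansion run to any larger length, in particular past [p]
   when [p] exceeds [n]. *)
pose c k : R := if (k <= n)%N then (y ^+ (n - k)) *+ 'C(n, k) else 0.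
have c0 k : 0 <= c k.
  by rewrite /c; case: ifP => // _; rewrite mulrn_wge0 ?exprn_ge0.
have E m t : (n < m)%N -> (y + t) ^+ n = \sum_(k < m) c k * t ^+ k.
  move=> nm; rewrite exprDn.
  rewrite (big_ord_widen m (fun k => y ^+ (n - k) * t ^+ k *+ 'C(n, k))) //.
  rewrite big_mkcond; apply: eq_bigr => k _; rewrite ltnS /c.
  by case: ifP => _; rewrite ?mul0r // mulrnAl.
exists c => t tD.
have nm : (n < (n + p).+1)%N by rewrite ltnS leq_addr.
have pm : (p <= (n + p).+1)%N by rewrite leqW // leq_addl.
rewrite (E _ t nm) (bigID (fun k : 'I__ => (k < p)%N)) /=.
rewrite -(big_ord_widen _ (fun k => c k * t ^+ k) pm) addrAC subrr add0r.
apply: le_trans (@power_tail_le _ _ _ _ _ _ p t D D1 tD _ _) _ => //.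
  by move=> k; rewrite -leqNgt.
rewrite ler_wpM2l ?exprn_ge0 //.
apply: (@le_trans _ _ ((y + D) ^+ n)); last first.
  have D0 := le_trans ler01 D1.
  by rewrite lerXn2r ?nnegrE ?addr_ge0 ?lerD2r // (le_trans y0).
rewrite (E _ D nm) [leRHS](bigID (fun k : 'I__ => (k < p)%N)) /= lerDr.
by rewrite sumr_ge0 // => k _; rewrite mulr_ge0 ?exprn_ge0 // (le_trans ler01).
Qed.

(** In the coordinate [ln], the power [w ^+ n] is the exponential of [n * ln w]. Its Taylor series
    about [y] again has nonnegative coefficients, so the tail argument applies to partial sums and
    passes to the limit. *)
Lemma expR_taylor (R : realType) (D Y : R) (p n : nat) (y : R) :
  1 <= D -> y <= Y -> exists d : nat -> R, forall t, `|t| <= D ->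
    `|expR (y + t) ^+ n - \sum_(k < p) d k * t ^+ k| <=
      `|t| ^+ p * expR (Y + D) ^+ n.
Proof.
move=> D1 yY; have D0 := le_trans ler01 D1.
pose c k : R := n%:R ^+ k / k`!%:R.
have c0 k : 0 <= c k by rewrite /c divr_ge0 ?exprn_ge0.
exists (fun k => expR y ^+ n * c k) => t tD.
have E : expR (y + t) ^+ n - \sum_(k < p) expR y ^+ n * c k * t ^+ k =
    expR y ^+ n * (expR (n%:R * t) - \sum_(k < p) c k * t ^+ k).
  rewrite expRD exprMn expRM_natl mulrBr; congr (_ - _).
  by rewrite mulr_sumr; apply: eq_bigr => k _; rewrite -mulrA.
rewrite E normrM ger0_norm ?exprn_ge0 ?expR_ge0 // expRD exprMn mulrCA.
apply: ler_pM; rewrite ?exprn_ge0 ?expR_ge0 //.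
  by rewrite lerXn2r ?nnegrE ?expR_ge0 // ler_expR.
rewrite -expRM_natl.
have cv (s : R) : series (exp_coeff (n%:R * s)) @ \oo --> expR (n%:R * s).
  exact: is_cvg_series_exp_coeff.
have cvD : `|series (exp_coeff (n%:R * t)) m - \sum_(k < p) c k * t ^+ k|
    @[m --> \oo]
    --> `|expR (n%:R * t) - \sum_(k < p) c k * t ^+ k|.
  by apply: cvg_norm; apply: cvgB => //; exact: cvg_cst.
have cvR : `|t| ^+ p * series (exp_coeff (n%:R * D)) m @[m --> \oo]
    --> `|t| ^+ p * expR (n%:R * D).
  by apply: cvgM => //; exact: cvg_cst.
apply: (@ler_cvg_to _ _ _ _ _ _ _ _ cvD cvR).
near=> m.
have pm : (p <= m)%N by near: m; exists p.
rewrite /series /= !big_mkord.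
have ES (s : R) : \sum_(k < m) exp_coeff (n%:R * s) k =
    \sum_(k < m) c k * s ^+ k.
  by apply: eq_bigr => k _; rewrite /exp_coeff /= /c exprMn mulrAC.
rewrite !ES (bigID (fun k : 'I__ => (k < p)%N)) /=.
rewrite -(big_ord_widen _ (fun k => c k * t ^+ k) pm) addrAC subrr add0r.
apply: le_trans (@power_tail_le _ _ _ _ _ _ p t D D1 tD _ _) _ => //.
  by move=> k; rewrite -leqNgt.
rewrite ler_wpM2l ?exprn_ge0 //.
rewrite [leRHS](bigID (fun k : 'I__ => (k < p)%N)) /= lerDr.
by rewrite sumr_ge0 // => k _; rewrite mulr_ge0 ?exprn_ge0.
Unshelve. all: by end_near. Qed.

(** * Stability of Lagrange interpolation *)

(** Lebesgue-constant argument: interpolation reproduces the polynomial [Q] of degree below [p], so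
    only deviations from [Q] contribute, once at [xi] and once per node weighted by its basis
    value. *)
Lemma lagrange_interp_error (R : realFieldType) (p : nat) (X : nat -> R)
    (xi e : R) (d : nat -> R) (v : 'I_p -> R) (v0 : R) (Lam : 'I_p -> R) :
  let l (a : 'I_p) :=
    \prod_(b < p | b != a) ((xi - X b) / (X a - X b)) in
  (0 < p)%N -> injective X ->
  `|v0 - \sum_(k < p) d k * (xi - xi) ^+ k| <= e ->
  (forall a : 'I_p, `|v a - \sum_(k < p) d k * (X a - xi) ^+ k| <= e) ->
  (forall a, `|l a| <= Lam a) ->
  `|v0 - \sum_(a < p) v a * l a| <= (1 + \sum_(a < p) Lam a) * e.
Proof.
move=> l p0 Xi e0 ea la.
pose Q : {poly R} := \sum_(k < p) d k *: ('X - xi%:P) ^+ k.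
have sQ : (size Q <= p)%N.
  apply: (leq_trans (size_sum _ _ _)); apply/bigmax_leqP => k _.
  by rewrite (leq_trans (size_scale_leq _ _)) // size_exp_XsubC.
have QE y : Q.[y] = \sum_(k < p) d k * (y - xi) ^+ k.
  by rewrite horner_sum; apply: eq_bigr => k _; rewrite !hornerE.
have lE : Q.[xi] = \sum_(a < p) Q.[X a] * l a.
  rewrite {1}(lagrange_gen p0 Xi sQ) horner_sum; apply: eq_bigr => a _.
  rewrite hornerM hornerC lagrangeE // hornerM hornerC !horner_prod -prodfV.
  rewrite -big_split /=; congr (_ * _); apply: eq_bigr => b _.
  by rewrite !hornerXsubC mulrC.
rewrite -!QE in e0.
have -> : v0 - \sum_(a < p) v a * l a =
    (v0 - Q.[xi]) - \sum_(a < p) (v a - Q.[X a]) * l a.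
  rewrite lE; under [X in _ = _ - X]eq_bigr do rewrite mulrBl.
  by rewrite sumrB; ring.
rewrite (le_trans (ler_normB _ _)) // mulrDl mul1r lerD //.
rewrite (le_trans (ler_norm_sum _ _ _)) // mulr_suml ler_sum // => a _.
by rewrite normrM mulrC ler_pM // QE.
Qed.

(** * The log-spaced table and its uniform interpolation error *)

Lemma ln_leB1 (R : realType) (y : R) : 0 < y -> ln y <= y - 1.
Proof.
move=> y0; have -> : ln y = ln (1 + (y - 1)) by congr ln; ring.
by apply: le_ln1Dx; lra.
Qed.

Section Table.
Variables (R : realType) (zmin zmax : R).
Hypothesis hz : 0 < zmin < zmax.

Let zmin0 : 0 < zmin. Proof. by case/andP: hz. Qed.
Let zmax0 : 0 < zmax. Proof. by case/andP: hz => /lt_trans; apply. Qed.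
Let pos (z : R) : zmin <= z <= zmax -> z \is Num.pos.
Proof. by case/andP=> /(lt_le_trans zmin0); rewrite posrE. Qed.

Lemma ln_ratio_gt0 : 0 < ln (zmax / zmin).
Proof. by rewrite ln_gt0 // ltr_pdivlMr // mul1r; case/andP: hz. Qed.

Lemma table_node_gt0 (M i : nat) : 0 < table_node zmin zmax M i.
Proof. by rewrite mulr_gt0 // powR_gt0 // divr_gt0. Qed.

Lemma ln_table_node (M i : nat) : ln (table_node zmin zmax M i) =
  ln zmin + i%:R * (ln (zmax / zmin) / M.-1%:R).
Proof.
rewrite /table_node lnM ?posrE ?powR_gt0 ?divr_gt0 // ln_powR; congr (_ + _).
by rewrite mulrA mulrAC.
Qed.

Lemma table_node_range (M i : nat) : (1 < M)%N -> (i < M)%N ->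
  zmin <= table_node zmin zmax M i <= zmax.
Proof.
move=> M1 iM; have L0 := ln_ratio_gt0.
have M0 : 0 < M.-1%:R :> R by rewrite ltr0n -subn1 subn_gt0.
rewrite -[X in X && _]ler_ln ?posrE ?table_node_gt0 //.
rewrite -[X in _ && X]ler_ln ?posrE ?table_node_gt0 // ln_table_node lerDl.
rewrite mulr_ge0 ?(divr_ge0 (ltW L0)) //=.
rewrite -lerBrDl -ln_div ?posrE // mulrCA ger_pMr //.
by rewrite ler_pdivrMr // mul1r ler_nat -ltnS (ltn_predK M1).
Qed.

Lemma stencil_ln_dist (p M : nat) (j : R -> nat) (z : R) (b : 'I_p) :
  (1 < M)%N -> is_stencil p zmin zmax M j -> zmin <= z <= zmax ->
  `|ln z - ln (table_node zmin zmax M (j z + b))| <=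
  p%:R * (ln (zmax / zmin) / M.-1%:R).
Proof.
move=> M1 js zr; have [_] := js z zr.
have h0 : 0 <= ln (zmax / zmin) / M.-1%:R.
  by rewrite divr_ge0 // ltW // ln_ratio_gt0.
(* For [p = 1] the only index is [b = 0] and the stencil condition is the bound itself; otherwise
   [z] and the node both lie between the extreme nodes of the stencil. *)
case: eqP => [p1|_].
  have -> : b = 0%N :> nat by have := ltn_ord b; lia.
  by rewrite addn0 p1 mul1r => /ltW.
rewrite -[X in X && _]ler_ln ?(pos zr) ?posrE ?table_node_gt0 //.
rewrite -[X in _ && X]ler_ln ?(pos zr) ?posrE ?table_node_gt0 //.
rewrite !ln_table_node; move: (ln (_ / _) / _) h0 => h h0.
have -> : (j z + p).-1 = (j z + p.-1)%N.
  by have := ltn_ord b; lia.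
have bp := ltn_ord b.
have [/= c0 c1] : (0 <= b%:R :> R) /\ (b%:R <= p%:R :> R).
  by rewrite ler0n ler_nat ltnW.
have c2 : p.-1%:R <= p%:R :> R by rewrite ler_nat leq_pred.
rewrite !natrD !mulrDl => /andP[lo hi].
have := ler_wpM2r h0 c1; have := mulr_ge0 c0 h0; have := ler_wpM2r h0 c2.
by move=> *; rewrite ler_norml; apply/andP; split; lra.
Qed.

(** This transfers spacing in [ln z] to either interpolation coordinate. For [id], the inequality
    [ln y <= y - 1] at [u / v] and at [v / u] yields the constants [zmin] and [zmax]. *)
Lemma table_coord_bilipschitz (x : R -> R) : x = @ln R \/ x = id ->
  exists m K : R, [/\ 0 < m, 0 < K & forall u v,
    zmin <= u <= zmax -> zmin <= v <= zmax ->
    m * `|ln u - ln v| <= `|x u - x v| <= K * `|ln u - ln v|].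
Proof.
case=> ->; first by exists 1, 1; split => // u v _ _; rewrite !mul1r lexx.
exists zmin, zmax; split => //.
move=> u v; wlog uv : u v / v <= u.
  move=> H ur vr; case/orP: (le_total v u) => [vu|uv]; first exact: H.
  by rewrite distrC [`|id u - _|]distrC; exact: H.
move=> ur vr; have up := pos ur; have vp := pos vr.
rewrite /= !ger0_norm ?subr_ge0 ?ler_ln // -ln_div //.
move: (up) (vp); rewrite !posrE => u0 v0.
case/andP: ur => ul uh; case/andP: vr => vl vh; apply/andP; split.
  have := ln_leB1 (divr_gt0 u0 v0).
  have -> : u / v - 1 = (u - v) / v by field; rewrite gt_eqF.
  rewrite ler_pdivlMr // => H; rewrite (le_trans _ H) // mulrC ler_wpM2l //.
  by rewrite ln_ge0 // ler_pdivlMr // mul1r.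
have := ln_leB1 (divr_gt0 v0 u0).
have -> : v / u - 1 = - ((u - v) / u) by field; rewrite gt_eqF.
rewrite -[v / u]invf_div lnV ?posrE ?divr_gt0 // lerN2 ler_pdivrMr // => H.
rewrite (le_trans H) // mulrC ler_wpM2r //.
by rewrite ln_ge0 // ler_pdivlMr // mul1r.
Qed.

Lemma expn_table_taylor (x : R -> R) (p : nat) : x = @ln R \/ x = id ->
  exists2 W : R, 0 < W & forall n z, zmin <= z <= zmax ->
    exists d : nat -> R, forall w, zmin <= w <= zmax ->
      `|(- w) ^+ n - \sum_(k < p) d k * (x w - x z) ^+ k| <=
      `|x w - x z| ^+ p * W ^+ n.
Proof.
move=> hx.
(* The sign [(-1) ^+ n] can be absorbed into the Taylor coefficients, so positive powers suffice. *)
suff [W W0 HW] : exists2 W : R, 0 < W & forall n z, zmin <= z <= zmax ->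
    exists d : nat -> R, forall w, zmin <= w <= zmax ->
      `|w ^+ n - \sum_(k < p) d k * (x w - x z) ^+ k| <=
      `|x w - x z| ^+ p * W ^+ n.
  exists W => // n z /(HW n)[d Hd]; exists (fun k => (-1) ^+ n * d k) => w /Hd.
  have -> : \sum_(k < p) (-1) ^+ n * d k * (x w - x z) ^+ k =
      (-1) ^+ n * \sum_(k < p) d k * (x w - x z) ^+ k.
    by rewrite mulr_sumr; apply: eq_bigr => k _; rewrite -mulrA.
  by rewrite [(- w) ^+ n]exprNn -mulrBr normrM normrX normrN1 expr1n mul1r.
case: hx => ->.
  (* The range width bounds every displacement [x w - x z]; the added 1 ensures that [D] is at least
     1. *)
  pose D := 1 + (ln zmax - ln zmin).
  have ln_range z : zmin <= z <= zmax -> ln zmin <= ln z <= ln zmax.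
    by move=> zr; rewrite !ler_ln ?(pos zr) ?posrE.
  have D1 : 1 <= D.
    by rewrite lerDl subr_ge0 ler_ln ?posrE // ltW //; case/andP: hz.
  exists (expR (ln zmax + D)) => [|n z zr]; first exact: expR_gt0.
  have /andP[zl zh] := ln_range z zr.
  have [d Hd] := expR_taylor p n D1 zh; exists d => w wr.
  have /andP[wl wh] := ln_range w wr.
  have := Hd (ln w - ln z).
  rewrite [ln z + _]addrC subrK lnK ?(pos wr) //; apply.
  by rewrite /D ler_norml; apply/andP; split; lra.
pose D := 1 + (zmax - zmin).
have D1 : 1 <= D by rewrite lerDl subr_ge0 ltW //; case/andP: hz.
exists (zmax + D) => [|n z zr].
  by rewrite addr_gt0 // (lt_le_trans ltr01).
case/andP: (zr) => zl zh.
have z0 : 0 <= z <= zmax by rewrite zh andbT (le_trans (ltW zmin0)).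
have [d Hd] := exprn_taylor p n D1 z0; exists d => w /andP[wl wh].
have := Hd (w - z); rewrite [z + _]addrC subrK; apply.
by rewrite /D ler_norml; apply/andP; split; lra.
Qed.

Lemma table_interp_sum (p M m : nat) (x : R -> R) (j : R -> nat)
    (c : nat -> R) (F : nat -> R -> R) (z : R) :
  table_interp p zmin zmax x M j
    (fun w => \sum_(0 <= n < m) c n * F n w) z =
  \sum_(0 <= n < m) c n * table_interp p zmin zmax x M j (F n) z.
Proof.
rewrite /table_interp; under eq_bigr do rewrite mulr_suml.
rewrite exchange_big; apply: eq_bigr => n _; rewrite mulr_sumr.
by apply: eq_bigr => a _; rewrite mulrA.
Qed.

(** At fixed [z] the interpolant is a finite combination of node values with fixed weights, so
    pointwise convergence is enough. *)
Lemma table_interp_cvg (p M : nat) (x : R -> R) (j : R -> nat)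
    (F : nat -> R -> R) (f : R -> R) (z : R) :
  (forall w, F m w @[m --> \oo] --> f w) ->
  table_interp p zmin zmax x M j (F m) z @[m --> \oo] -->
  table_interp p zmin zmax x M j f z.
Proof.
move=> Ff; apply: cvg_big => [|a _]; first exact: add_continuous.
by apply: cvgM; [exact: Ff | exact: cvg_cst].
Qed.

Lemma table_interp_error_le (alpha : R) (p : nat) (x : R -> R) :
  0 < alpha -> (0 < p)%N -> x = @ln R \/ x = id ->
  exists C : R, forall (M : nat) (j : R -> nat) (z : R),
    (1 < M)%N -> is_stencil p zmin zmax M j -> zmin <= z <= zmax ->
    `|g_ml alpha z - table_interp p zmin zmax x M j (g_ml alpha) z| <=
    C * M%:R ^- p.
Proof.
move=> a0 p0 hx.
have [m [K [m0 K0 xmK]]] := table_coord_bilipschitz hx.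
have [W W0 HW] := expn_table_taylor p hx.
have [B B0 HB] := inv_Gamma_le a0 W0.
pose L := ln (zmax / zmin); have L0 : 0 < L := ln_ratio_gt0.
(* Each Lagrange factor is at most [K p h / (m h)]; the spacing [h] cancels, so the Lebesgue
   constant [A] is independent of [M]. *)
pose Lam (a : 'I_p) := \prod_(b < p | b != a) (K * p%:R / m).
pose A := 1 + \sum_a Lam a.
have A0 : 0 <= A.
  rewrite addr_ge0 // sumr_ge0 // => a _; rewrite prodr_ge0 // => b _.
  by rewrite divr_ge0 ?mulr_ge0 // ltW.
(* [2 * B] comes from summing the geometric bound on the coefficients; the 2 inside the power comes
   from [1 / (M - 1) <= 2 / M], valid for [M >= 2]. *)
exists (A * (2 * B) * (2 * K * p%:R * L) ^+ p) => M j z M1 js zr.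
pose h := L / M.-1%:R.
have M0 : 0 < M.-1%:R :> R by rewrite ltr0n -subn1 subn_gt0.
have h0 : 0 < h by rewrite divr_gt0.
pose H := K * (p%:R * h).
have H0 : 0 <= H by rewrite !mulr_ge0 // ltW.
have HM : H <= 2 * K * p%:R * L * M%:R^-1.
  have -> : H = K * p%:R * L / M.-1%:R by rewrite /H /h !mulrA.
  have -> : 2 * K * p%:R * L * M%:R^-1 = K * p%:R * L * (2 / M%:R) by ring.
  rewrite ler_wpM2l ?mulr_ge0 ?(ltW L0) ?(ltW K0) //.
  rewrite -[2 / _]invf_div lef_pV2 ?posrE ?divr_gt0 ?M0 ?ltr0n ?(ltnW M1) //.
  rewrite ler_pdivrMr // -natrM ler_nat mulnC mul2n -addnn.
  by case: (M) M1 => [|[|n]] //= _; rewrite addSn addnS !ltnS leq_addl.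
pose node (a : nat) := table_node zmin zmax M (j z + a).
have nr (a : 'I_p) : zmin <= node a <= zmax.
  apply: table_node_range => //; apply: leq_trans (js z zr).1.
  by rewrite ltn_add2l.
have nodeI : injective (x \o node).
  move=> a b /= E.
  have : ln (node a) = ln (node b).
    case: hx E => -> //; first by move=> ->.
  rewrite !ln_table_node => /addrI /(mulIf (lt0r_neq0 h0)) /eqP.
  by rewrite eqr_nat eqn_add2l => /eqP.
have dist (a : 'I_p) : `|x z - x (node a)| <= H.
  have /andP[_ /le_trans] := xmK _ _ zr (nr a); apply.
  by rewrite ler_wpM2l ?(ltW K0) // stencil_ln_dist.
(* Distinct nodes differ by at least one spacing [h] in [ln], hence by at least [m * h] in the
   coordinate [x]. *)
have sep (a b : 'I_p) : b != a -> m * h <= `|x (node a) - x (node b)|.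
  move=> ba; have /andP[le_m _] := xmK _ _ (nr a) (nr b).
  apply: le_trans le_m; rewrite ler_wpM2l ?(ltW m0) // !ln_table_node.
  rewrite -/L -/h opprD addrACA subrr add0r -mulrBl normrM (gtr0_norm h0).
  rewrite ler_peMl ?(ltW h0) // !natrD opprD addrACA subrr add0r.
  have : (a : nat) != b by rewrite eq_sym.
  rewrite neq_ltn => /orP[] ab; last first.
    by rewrite -natrB ?(ltnW ab) // ger0_norm // ler1n subn_gt0.
  by rewrite distrC -natrB ?(ltnW ab) // ger0_norm // ler1n subn_gt0.
have lamP (a : 'I_p) : `|\prod_(b < p | b != a)
    ((x z - x (node b)) / (x (node a) - x (node b)))| <= Lam a.
  rewrite normr_prod; apply: ler_prod => b ba; rewrite normr_ge0 /=.
  rewrite normrM normfV.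
  have -> : K * p%:R / m = H / (m * h) by rewrite /H; field; rewrite !gt_eqF.
  have mh0 : 0 < m * h by rewrite mulr_gt0.
  have s0 := lt_le_trans mh0 (sep _ _ ba).
  by rewrite ler_pM ?invr_ge0 // lef_pV2 // sep.
have err n : `|(- z) ^+ n - table_interp p zmin zmax x M j
    (fun w => (- w) ^+ n) z| <= A * (H ^+ p * W ^+ n).
  have [d Hd] := HW n z zr.
  have HWn0 : 0 <= H ^+ p * W ^+ n by rewrite mulr_ge0 ?exprn_ge0 // ltW.
  apply: (@lagrange_interp_error _ _ (x \o node) (x z) _ d) => //=.
    (* At [z] itself the Taylor remainder is zero, since [0 ^+ p = 0] for positive [p]. *)
    apply: le_trans (Hd _ zr) _.
    by rewrite subrr normr0 expr0n eqn0Ngt p0 mul0r.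
  move=> a; apply: le_trans (Hd _ (nr a)) _.
  by rewrite ler_wpM2r ?exprn_ge0 ?(ltW W0) // lerXn2r ?nnegrE // distrC.
pose b n := (Gamma (1 + alpha * n%:R))^-1.
pose S k w := \sum_(0 <= n < k) b n * (- w) ^+ n.
have Scvg w : S k w @[k --> \oo] --> g_ml alpha w.
  have := @g_ml_cvg R alpha w a0; apply: cvg_trans; apply: near_eq_cvg.
  by near=> k; rewrite /S /series /=; apply: eq_bigr => n _; rewrite mulrC.
have cvg_err : `|S k z - table_interp p zmin zmax x M j (S k) z| @[k --> \oo]
    --> `|g_ml alpha z - table_interp p zmin zmax x M j (g_ml alpha) z|.
  by apply: cvg_norm; apply: cvgB => //; exact: table_interp_cvg.
apply: (@le_trans _ _ (A * (2 * B) * H ^+ p)); last first.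
  rewrite -[leRHS]mulrA ler_wpM2l ?mulr_ge0 // -exprVn -exprMn.
  rewrite lerXn2r ?nnegrE //.
  exact: le_trans HM.
(* The bound is proved for the partial sums [S k], where linearity reduces it to single powers, and
   survives the limit because it is a closed condition. *)
apply: (@closed_cvg _ _ _ _ _ (fun y => y <= A * (2 * B) * H ^+ p)
  _ _ _ cvg_err).
  exact: closed_le.
near=> k; rewrite table_interp_sum /S -sumrB.
under eq_bigr do rewrite -mulrBr.
rewrite (le_trans (ler_norm_sum _ _ _)) //.
apply: (@le_trans _ _ (\sum_(0 <= n < k) A * H ^+ p * (B * 2^-1 ^+ n))).
  apply: ler_sum => n _; rewrite normrM.
  apply: (@le_trans _ _ (`|b n| * (A * (H ^+ p * W ^+ n)))).
    by rewrite ler_wpM2l.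
  have -> : `|b n| * (A * (H ^+ p * W ^+ n)) = A * H ^+ p * (`|b n| * W ^+ n).
    by ring.
  by rewrite ler_wpM2l ?HB ?mulr_ge0 ?exprn_ge0.
rewrite -!mulr_sumr.
have -> : A * (2 * B) * H ^+ p = A * H ^+ p * (B * 2) by ring.
rewrite ler_wpM2l ?mulr_ge0 ?exprn_ge0 // ler_wpM2l //.
exact: sum_half_le2.
Unshelve. all: by end_near. Qed.

End Table.

(** * From the scalar table error to the assembled base field *)

Theorem mainTheorem5 (R : realType) (alpha : R) (halpha : 0 < alpha <= 1)
    (p : nat) (hp : (0 < p)%N) (zmin zmax : R) (hz : 0 < zmin < zmax)
    (x : R -> R) (hx : x = @ln R \/ x = id) :
  (* the propagator acts on each mode as the scalar g_alpha(z_k) *)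
  (forall (s c T : R) (N : nat) (q : 'I_N -> 'I_N -> R),
     0 < s <= 1 -> 0 < c -> 0 < T -> (0 < N)%N -> is_mode_eigenvalue q ->
     forall (u0 : 'M[R]_N) (k l : 'I_N),
       mode_coef (u_base_star alpha s c T q u0) k l =
       g_ml alpha (mode_z alpha s c T q k l) * mode_coef u0 k l)
  /\
  (exists C : R, forall (M : nat) (j : R -> nat),
     (1 < M)%N -> (p <= M)%N -> is_stencil p zmin zmax M j ->
     (eps_tab alpha p zmin zmax x M j <= (C * M%:R ^- p)%:E)%E)
  /\
  (forall (M : nat) (j : R -> nat),
     (1 < M)%N -> (p <= M)%N -> is_stencil p zmin zmax M j ->
     forall (s c T : R) (N : nat) (q : 'I_N -> 'I_N -> R),
       0 < s <= 1 -> 0 < c -> 0 < T -> (0 < N)%N -> is_mode_eigenvalue q ->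
       (forall k l : 'I_N, zmin <= mode_z alpha s c T q k l <= zmax) ->
       forall u0 : 'M[R]_N,
         ((grid_L2norm (u_base alpha s c T p zmin zmax x M j q u0
                        - u_base_star alpha s c T q u0))%:E
          <= eps_tab alpha p zmin zmax x M j * (grid_L2norm u0)%:E)%E).
Proof.
case/andP: halpha => a0 _.
have [C HC] := table_interp_error_le hz a0 hp hx.
have epsC (M : nat) (j : R -> nat) : (1 < M)%N ->
    is_stencil p zmin zmax M j ->
    (eps_tab alpha p zmin zmax x M j <= (C * M%:R ^- p)%:E)%E.
  move=> M1 js; apply: ge_ereal_sup => _ [z zr <-].
  by rewrite lee_fin HC.
split; first by move=> *; exact: mode_coef_multiplier.
split; first by exists C => M j M1 _; exact: epsC.
move=> M j M1 _ js s c T N q _ _ _ N0 _ qr u0.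
pose k0 := Ordinal N0.
have ubound z : zmin <= z <= zmax ->
    ((`|g_ml alpha z - table_interp p zmin zmax x M j (g_ml alpha) z|)%:E
      <= eps_tab alpha p zmin zmax x M j)%E.
  by move=> zr; apply: ereal_sup_ubound; exists z.
(* The supremum is a real number [e]: the [M ^- p] bound excludes [+oo], and the value at the mode
   [k0], which exists as [0 < N], excludes [-oo]. *)
move: ubound (epsC M j M1 js); case: eps_tab => [e| |] ubound //= _; last first.
  by have := ubound _ (qr k0 k0).
(* Both fields are multipliers of the same [u0], so their difference is a multiplier by the
   pointwise table defect. *)
have -> : u_base alpha s c T p zmin zmax x M j q u0 -
    u_base_star alpha s c T q u0 = mode_multiplier (fun k l =>
      table_interp p zmin zmax x M j (g_ml alpha) (mode_z alpha s c T q k l) -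
      g_ml alpha (mode_z alpha s c T q k l)) u0.
  rewrite /u_base /u_base_star !mode_multiplierE -sumrB.
  by apply: eq_bigr => k _; rewrite -scalerBl -mulrBl.
rewrite -EFinM lee_fin; apply: grid_L2norm_multiplier_le.
  by have := ubound _ (qr k0 k0); rewrite lee_fin; apply: le_trans.
by move=> k l; rewrite distrC -lee_fin; exact: ubound.
Qed.
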